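(* Let $\vec\alpha=(\alpha_i)_{i\ge1}$, $\vec\beta=(\beta_i)_{i\ge1}$ be sequences of non-negative reals and $\gamma\ge0$ a real with $\gamma+\sum_i\alpha_i+\sum_i\beta_i=1$. Then the separation distance between $k$ applications of a $(\vec\alpha,\vec\beta,\gamma)$ shuffle of an $n$ card deck and the uniform distribution on $S_n$ is at most $$\binom n2\left[\sum_i\alpha_i^2+\sum_i\beta_i^2\right]^k.$$ Thus $$k=2\log_{\frac{1}{\sum_i\alpha_i^2+\sum_i\beta_i^2}}n$$ steps suffice to get close to the uniform distribution.
   Context: **Separation distance.** The separation distance between a probability $P$ on $S_n$ and the uniform distribution $U$ is $\max_{\pi\in S_n}\left(1-\frac{P(\pi)}{U(\pi)}\right)$; it is an upper bound on total variation distance. The distribution after $k$ applications of a shuffle is the $k$-fold convolution power of the shuffle measure on the group $S_n$. **$(\vec\alpha,\vec\beta,\gamma)$ shuffle.** This is the following probability measure on $S_n$. Choose a word $w_1\cdots w_n$ of integers with independent letters: each letter equals $i>0$ with probability $\alpha_i$, equals $-i<0$ with probability $\beta_i$ ($i\geq 1$), and equals $0$ with probability $\gamma$. Process the distinct letters occurring in the word in increasing order (usual order on $\mathbb Z$), assigning to the positions of each letter the next unused block of consecutive integers from $1,2,\dots,n$ (the block having as many elements as the letter has occurrences). Within the block of a negative letter, the integers are written under its occurrences in decreasing order from left to right. Within the block of a positive letter, they are written in increasing order from left to right. Within the block of the letter $0$, they are written in a uniformly random order (independent of everything else). Then $\pi(j)$ is the integer written under $w_j$. *)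

(* Defs.v *)
From mathcomp Require Export all_boot all_order all_algebra all_fingroup.
From mathcomp Require Export all_classical all_reals all_analysis.
Export Order.TTheory GRing.Theory Num.Theory numFieldNormedType.Exports.

Set Implicit Arguments.
Unset Strict Implicit.
Unset Printing Implicit Defensive.

Local Open Scope classical_set_scope.
Local Open Scope ring_scope.

(* Conventions: the sequences alpha and beta are indexed from 1 (their values
   at 0 are never used); positions and card values 1..n are represented by the
   elements 0..n-1 of 'I_n. *)

Definition letter_prob (R : realType) (alpha beta : nat -> R) (gamma : R)
    (a : int) : R :=
  if 0 < a then alpha `|a|%N else if a < 0 then beta `|a|%N else gamma.

Definition word_prob (R : realType) (alpha beta : nat -> R) (gamma : R)
    (n : nat) (w : {ffun 'I_n -> int}) : R :=
  \prod_(j < n) letter_prob alpha beta gamma (w j).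

(* Processing letters in increasing order gives the letter a the block of all
   v with #{i | w i < a} <= v < #{i | w i <= a}; [arranges w pi] says that pi
   writes each block under its letter, decreasingly for negative letters,
   increasingly for positive ones, with no constraint inside the block of 0. *)
Definition arranges (n : nat) (w : {ffun 'I_n -> int}) (pi : 'S_n) : bool :=
  [forall j : 'I_n,
     (#|[set i | (w i < w j)%R]%SET| <= pi j < #|[set i | (w i <= w j)%R]%SET|)%N]
  && [forall i : 'I_n, forall j : 'I_n,
     ((i < j)%N && (w i == w j)) ==>
       (((w i < 0) ==> (pi j < pi i)%N) && ((0 < w i) ==> (pi i < pi j)%N))].

(* Conditional probability of pi given the word w: only the order inside the
   block of 0 is random, uniform among its m`! arrangements, where m is the
   number of occurrences of 0. *)
Definition arrangement_prob (R : realType) (n : nat) (w : {ffun 'I_n -> int})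
    (pi : 'S_n) : R :=
  if arranges w pi then (#|[set i | w i == 0]%SET| `!)%:R^-1 else 0.

(* Law of total probability over the countably many words. *)
Definition shuffle (R : realType) (alpha beta : nat -> R) (gamma : R) (n : nat)
    (pi : 'S_n) : R :=
  fine (\esum_(w in [set: {ffun 'I_n -> int}])
    (word_prob alpha beta gamma w * arrangement_prob R w pi)%:E).

Definition convolution (R : realType) (n : nat) (P Q : 'S_n -> R)
    (pi : 'S_n) : R :=
  \sum_(sigma : 'S_n) P sigma * Q (sigma^-1 * pi)%g.

Definition point_mass1 (R : realType) (n : nat) (pi : 'S_n) : R :=
  (pi == 1%g)%:R.

Definition convolution_power (R : realType) (n : nat) (P : 'S_n -> R)
    (k : nat) : 'S_n -> R :=
  iter k (convolution P) (@point_mass1 R n).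

Definition uniform_perm (R : realType) (n : nat) (pi : 'S_n) : R :=
  #|{: 'S_n}|%:R^-1.

(* The base value of the iterated maximum is the term of the identity, so that
   this is the genuine maximum over 'S_n. *)
Definition separation_distance (R : realType) (n : nat) (P : 'S_n -> R) : R :=
  let F (pi : 'S_n) := 1 - P pi / uniform_perm R pi in
  \big[Num.max/F 1%g]_(pi : 'S_n) F pi.

Definition log_base (R : realType) (b x : R) : R := ln x / ln b.

(* Main.v *)
Require Import Defs.
From mathcomp Require Import zify ring.

(* Follow each card through the k shuffles and record its k letters.  A pair of
   cards is resolved if at some step its two letters differ or are both 0.  When
   two adjacent cards form a resolved pair, exchanging them in the initial deck
   does not change the law of the final deck; since adjacent transpositions
   generate S_n, the law of the final deck given letters that resolve all pairs
   does not depend on the initial deck at all, so it becomes uniform after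
   averaging over the relabellings of the cards.  A given pair is unresolved with
   probability s^k, and the union bound gives P^k(pi) >= (1 - C(n,2) s^k) / n!.
   To have finite sums only, the letters are restricted to [-M, M], which gives a
   measure below the shuffle whose mass tends to 1 with M. *)

Set Implicit Arguments.
Unset Strict Implicit.
Unset Printing Implicit Defensive.

Local Open Scope ring_scope.

Lemma card_ord_lt (n m : nat) : (m <= n)%N -> #|[set x : 'I_n | (x < m)%N]%SET| = m.
Proof.
move=> mn.
have inj : injective (widen_ord mn) by move=> x y /(congr1 val) /= /val_inj.
rewrite -[RHS]card_ord -[RHS](card_imset _ inj).
apply: eq_card => x; rewrite inE; apply/idP/imsetP => [xm|[y _ ->]]; last exact: (ltn_ord y).
by exists (Ordinal xm) => //; apply: val_inj.
Qed.

(** * Arrangements and the initial order of the deck *)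

Section Arrangements.
Variable n : nat.
Implicit Types (w : {ffun 'I_n -> int}) (s rho sigma tau theta : 'S_n).

(* The blocks are determined by the relative orders alone. *)
Lemma arrangesP w s :
  reflect ((forall i j, w i < w j -> (s i < s j)%N) /\
           (forall i j : 'I_n, (i < j)%N -> w i = w j ->
              (w i < 0 -> (s j < s i)%N) /\ (0 < w i -> (s i < s j)%N)))
          (arranges w s).
Proof.
apply: (iffP andP) => [[/forallP blk /forallP ord]|[inc ord]].
  split=> [i j wij|i j ij wij].
    have /andP[_ si] := blk i; have /andP[sj _] := blk j.
    apply: leq_trans si (leq_trans _ sj); apply: subset_leq_card.
    by apply/fintype.subsetP => l; rewrite !inE => /le_lt_trans; apply.
  have /forallP/(_ j) := ord i; rewrite ij wij eqxx /= => /andP[a b].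
  by split; apply/implyP.
split; apply/forallP => j; last first.
  apply/forallP => l; apply/implyP => /andP[jl /eqP wjl].
  by have [a b] := ord _ _ jl wjl; apply/andP; split; apply/implyP.
apply/andP; split.
  (* Block bounds by counting: [s] injects the positions with a smaller letter into the values below
     [s j]. *)
  rewrite -[leqRHS](card_ord_lt (ltnW (ltn_ord (s j)))).
  rewrite -(card_imset _ (@perm_inj _ s)); apply: subset_leq_card.
  by apply/fintype.subsetP => _ /imsetP[l + ->]; rewrite !inE => /inc.
rewrite -[X in (X <= _)%N](card_ord_lt (ltn_ord (s j))).
rewrite -[leqRHS](card_imset _ (@perm_inj _ s)); apply: subset_leq_card.
apply/fintype.subsetP => x; rewrite inE ltnS => xj.
apply/imsetP; exists (s^-1%g x); last by rewrite permKV.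
rewrite inE leNgt; apply/negP => /inc.
by rewrite permKV ltnNge xj.
Qed.

(* [w] gives the letter of each card and [rho] its position; the result gives
   the letter found at each position. *)
Definition relabel rho w : {ffun 'I_n -> int} := [ffun j => w (rho^-1%g j)].

(** Products of permutations act left to right, so [rho^-1 * sigma] sends the old position of each
    card to its new one. *)
Definition card_arranges w rho sigma :=
  arranges (relabel rho w) (rho^-1 * sigma)%g.

Lemma card_arrangesP w rho sigma :
  reflect ((forall x y, w x < w y -> (sigma x < sigma y)%N) /\
           (forall x y, (rho x < rho y)%N -> w x = w y ->
              (w x < 0 -> (sigma y < sigma x)%N) /\ (0 < w x -> (sigma x < sigma y)%N)))
          (card_arranges w rho sigma).
Proof.
apply: (iffP (arrangesP _ _)) => -[inc ord]; split=> x y.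
- move=> wxy; have := inc (rho x) (rho y).
  by rewrite !ffunE !permM !permK; apply.
- move=> rxy wxy; have := ord (rho x) (rho y) rxy.
  by rewrite !ffunE !permM !permK; apply.
- by rewrite !ffunE !permM; apply: inc.
- by move=> xy; rewrite !ffunE !permM; apply: ord; rewrite !permKV.
Qed.

Lemma perm_ltn_total s x y : x != y -> (s y < s x)%N = ~~ (s x < s y)%N.
Proof.
by move=> xy; rewrite -leqNgt ltn_neqAle (inj_eq val_inj) (inj_eq perm_inj) eq_sym xy.
Qed.

(* No third card lies between the cards [x] and [y]. *)
Definition neighbours rho x y :=
  forall z, z != x -> z != y -> (rho z < rho x)%N = (rho z < rho y)%N.

(** A third card compares in the same way with [x] and with [y], so the swap alters only their
    mutual order. *)
Lemma neighbours_swap rho x y z t : neighbours rho x y ->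
  ~~ ((z == x) && (t == y)) -> ~~ ((z == y) && (t == x)) ->
  ((tperm x y * rho)%g z < (tperm x y * rho)%g t)%N = (rho z < rho t)%N.
Proof.
move=> nb; rewrite !permM.
have nb' u : u != x -> u != y -> (rho x < rho u)%N = (rho y < rho u)%N.
  by move=> ux uy; rewrite (perm_ltn_total _ ux) (perm_ltn_total _ uy) nb.
case: (tpermP x y z) => [->|->|/eqP zx /eqP zy];
  case: (tpermP x y t) => [->|->|/eqP tx /eqP ty];
  rewrite ?eqxx ?ltnn //= => _ _.
- by rewrite nb'.
- by rewrite nb'.
- by rewrite nb.
- by rewrite nb.
Qed.

(** The old mutual order of two cards constrains [sigma] only when their letters are equal and
    nonzero. *)
Lemma card_arranges_swap w rho sigma x y : neighbours rho x y ->
  w x != w y \/ w x = 0 ->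
  card_arranges w rho sigma -> card_arranges w (tperm x y * rho)%g sigma.
Proof.
move=> nb free /card_arrangesP[inc ord]; apply/card_arrangesP; split=> // z t.
have [/andP[/eqP -> /eqP ->]|nxy] := boolP ((z == x) && (t == y)).
  by move=> _ wxy; case: free => [/eqP//|w0]; rewrite w0 ltxx; split.
have [/andP[/eqP -> /eqP ->]|nyx] := boolP ((z == y) && (t == x)).
  by move=> _ wxy; case: free => [|w0]; rewrite wxy ?eqxx // w0 ltxx; split.
by rewrite neighbours_swap //; apply: ord.
Qed.

Lemma neighbours_tperm rho x y : neighbours rho x y -> neighbours (tperm x y * rho)%g x y.
Proof.
move=> nb z zx zy; rewrite !permM tpermL tpermR tpermD 1?eq_sym //.
by rewrite nb.
Qed.

(** A card with another letter lands on one side of the whole block; within the block the old order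
    is kept or reversed, so nothing comes between [x] and [y]. *)
Lemma neighbours_card_arranges w rho sigma x y : neighbours rho x y ->
  w x = w y -> w x != 0 -> card_arranges w rho sigma -> neighbours sigma x y.
Proof.
move=> nb wxy w0 /card_arrangesP[inc ord] z zx zy.
case: (ltgtP (w z) (w x)) => wzx.
- by rewrite !inc // -wxy.
- rewrite (@perm_ltn_total sigma x z) 1?eq_sym // (@perm_ltn_total sigma y z) 1?eq_sym //.
  by rewrite !inc // -wxy.
have wzy : w z = w y by rewrite wzx.
(* The exclusive or treats both signs at once: order kept for a positive letter, reversed for a
   negative one. *)
have key u : z != u -> w z = w u -> (sigma z < sigma u)%N = (0 < w z) (+) (rho u < rho z)%N.
  move=> zu wzu; have uz : u != z by rewrite eq_sym.
  have [/ord/(_ (esym wzu))[]|] := boolP (rho u < rho z)%N.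
    rewrite -wzu wzx; case: (ltgtP (w x) 0) w0 => //= _ _ a b; first by rewrite a.
    by rewrite (perm_ltn_total _ uz) b.
  rewrite -(perm_ltn_total _ uz) => /ord/(_ wzu)[].
  rewrite wzx; case: (ltgtP (w x) 0) w0 => //= _ _ a b; last by rewrite b.
  by rewrite (perm_ltn_total _ uz) a.
by rewrite !key // (@perm_ltn_total rho z x) // (@perm_ltn_total rho z y) // nb.
Qed.


(** * Generation of the symmetric group by adjacent transpositions *)

Lemma adjacent_invariant_const (X : Type) (f : 'S_n -> X) :
  (forall rho x y, neighbours rho x y -> f (tperm x y * rho)%g = f rho) ->
  forall rho, f rho = f 1%g.
Proof.
move=> fN.
have step1 (p q : 'I_n) rho : q = p.+1 :> nat -> f (rho * tperm p q)%g = f rho.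
  move=> qp; have -> : (rho * tperm p q = tperm (rho^-1%g p) (rho^-1%g q) * rho)%g.
    by rewrite -tpermJ conjgE invgK -!mulgA mulVg mulg1.
  apply: fN => z zp zq; rewrite !permKV qp ltnS [RHS]leq_eqVlt.
  suff -> : (nat_of_ord (rho z) == p) = false by [].
  by rewrite (inj_eq val_inj) (can2_eq (permK rho) (permKV rho)); apply/negbTE.
have step d (p q : 'I_n) rho : q = (p + d.+1)%N :> nat -> f (rho * tperm p q)%g = f rho.
  elim: d q rho => [|d IH] q rho qE; first by apply: step1; rewrite qE addn1.
  have rn : (p + d.+1 < n)%N by apply: leq_trans (ltn_ord q); rewrite qE !addnS.
  pose r := Ordinal rn.
  (* Conjugation by the adjacent transposition of [r] and [q] shortens the distance by one. *)
  have -> : tperm p q = (tperm r q * tperm p r * tperm r q)%g.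
    rewrite -{1}(tpermV r q) -mulgA -conjgE tpermJ tpermL tpermD //.
      by rewrite -(inj_eq val_inj) /=; lia.
    by rewrite -(inj_eq val_inj) /=; lia.
  rewrite !mulgA step1 ?IH ?step1 //=; lia.
have stepT (p q : 'I_n) rho : f (rho * tperm p q)%g = f rho.
  case: (ltngtP p q) => [pq|pq|/val_inj ->]; last by rewrite tperm1 mulg1.
    by apply: (step (q - p).-1); lia.
  by rewrite tpermC; apply: (step (p - q).-1); lia.
move=> rho; have [ts -> _] := prod_tpermP rho.
elim/last_ind: ts => [|ts t IH]; first by rewrite big_nil.
by rewrite -cats1 big_cat big_seq1 /= stepT.
Qed.

(** * Total mass of the arrangements of a word *)

(** Positions are ranked by letter, ties being broken from right to left for negative letters and
    from left to right otherwise. *)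
Lemma arranges_exists w : exists s, arranges w s.
Proof.
pose before (i j : 'I_n) :=
  (w i < w j) || ((w i == w j) && (if w i < 0 then (j < i)%N else (i < j)%N)).
have bxx i : before i i = false by rewrite /before ltxx eqxx /= ltnn if_same.
have btr i j l : before i j -> before j l -> before i l.
  rewrite /before => /orP[ij|/andP[/eqP <- ij]] /orP[jl|/andP[/eqP wjl jl]].
  - by rewrite (lt_trans ij jl).
  - by rewrite -wjl ij.
  - by rewrite jl.
  - rewrite -wjl eqxx /= ltxx /=.
    by case: (w i < 0) ij jl => ij jl; [apply: ltn_trans jl ij|apply: ltn_trans ij jl].
have btot i j : i != j -> before i j || before j i.
  rewrite /before => ij; case: (ltgtP (w i) (w j)) => //= ->.
  have : (i != j :> nat) by rewrite (inj_eq val_inj).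
  by case: ifP => _; rewrite neq_ltn // orbC.
pose rk j := #|[set i | before i j]%SET|.
have rkn j : (rk j < n)%N.
  rewrite -[X in (_ < X)%N]card_ord -cardsT; apply: proper_card.
  by apply/properP; split; [apply: finset.subsetT|exists j; rewrite ?inE ?bxx].
have rk_lt i j : before i j -> (rk i < rk j)%N.
  move=> ij; apply: proper_card; apply/properP; split.
    by apply/fintype.subsetP => l; rewrite !inE => /btr; apply.
  by exists i; rewrite inE ?ij ?bxx.
have rk_inj : injective (fun j => Ordinal (rkn j)).
  move=> i j /(congr1 val) /= e; apply/eqP; apply: contraT => /btot.
  by case/orP=> /rk_lt; rewrite e ltnn.
exists (perm rk_inj); apply/arrangesP; split=> i j.
  by move=> wij; rewrite !permE /=; apply: rk_lt; rewrite /before wij.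
move=> ij wij; split=> wi; rewrite !permE /=; apply: rk_lt; rewrite /before wij eqxx.
  by rewrite -wij wi ij orbT.
by rewrite -wij (le_gtF (ltW wi)) ij orbT.
Qed.

Variable R : realType.

Lemma arrangement_prob_ge0 w s : 0 <= arrangement_prob R w s.
Proof. by rewrite /arrangement_prob; case: ifP => // _; rewrite invr_ge0 ler0n. Qed.

(** Composing one arrangement with the m! permutations of the positions of 0 gives m! arrangements,
    each of probability 1/m!. *)
Lemma sum_arrangement_prob_ge1 w : 1 <= \sum_s arrangement_prob R w s.
Proof.
set Z := [set i | w i == 0]%SET.
have [s0 /arrangesP[inc ord]] := arranges_exists w.
have wk k : perm_on Z k -> forall i, w (k i) = w i.
  move=> kZ i; have [iZ|iZ] := boolP (i \in Z); last by rewrite (out_perm kZ).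
  by have := iZ; rewrite -(perm_closed _ kZ); move: iZ; rewrite !inE => /eqP-> /eqP->.
have ks k : perm_on Z k -> arranges w (k * s0)%g.
  move=> kZ; apply/arrangesP; split=> i j.
    by rewrite -{1}(wk _ kZ i) -{1}(wk _ kZ j) !permM => /inc.
  move=> ij wij; have [w0|w0] := eqVneq (w i) 0; first by rewrite w0 ltxx.
  by rewrite !permM !(out_perm kZ) ?inE -?wij //; apply: ord.
rewrite -big_mkcond /= sumr_const.
have cZ : (#|Z| `! <= #|[pred s | arranges w s]|)%N.
  rewrite -card_perm -(card_imset _ (@mulIg _ s0)); apply: subset_leq_card.
  by apply/fintype.subsetP => _ /imsetP[k kZ ->]; rewrite inE ks.
by rewrite -[leRHS]mulr_natl ler_pdivlMr ?ltr0n ?fact_gt0 // mul1r ler_nat.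
Qed.

(** * Cards followed through several shuffles *)

Definition step_prob w rho sigma : R := arrangement_prob R (relabel rho w) (rho^-1 * sigma)%g.

Lemma step_probE w rho sigma :
  step_prob w rho sigma =
    if card_arranges w rho sigma then (#|[set x | w x == 0]%SET| `!)%:R^-1 else 0.
Proof.
rewrite /step_prob /arrangement_prob; congr (if _ then (_ `!)%:R^-1 else _).
rewrite -[RHS](card_imset _ (@perm_inj _ rho)); apply: eq_card => i; rewrite inE ffunE.
apply/idP/imsetP => [wi|[x + ->]]; last by rewrite inE permK.
by exists (rho^-1%g i); rewrite ?inE ?permKV.
Qed.

(* The probability that the cards end at [theta], given that they start at [rho]
   and that [a] lists their successive letters. *)
Fixpoint path_prob (a : seq {ffun 'I_n -> int}) rho theta : R :=
  if a is w :: a' then \sum_sigma step_prob w rho sigma * path_prob a' sigma theta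
  else (rho == theta)%:R.

Lemma step_prob_ge0 w rho sigma : 0 <= step_prob w rho sigma.
Proof. exact: arrangement_prob_ge0. Qed.

Lemma path_prob_ge0 a rho theta : 0 <= path_prob a rho theta.
Proof.
elim: a rho => [|w a IH] rho /=; first exact: ler0n.
by apply: sumr_ge0 => sigma _; rewrite mulr_ge0 ?step_prob_ge0.
Qed.

Lemma sum_path_prob_ge1 a rho : 1 <= \sum_theta path_prob a rho theta.
Proof.
elim: a rho => [|w a IH] rho /=.
  by rewrite (bigD1 rho) //= eqxx lerDl; apply: sumr_ge0 => *; apply: ler0n.
rewrite exchange_big /=; apply: le_trans (_ : \sum_sigma step_prob w rho sigma <= _).
  rewrite (reindex_inj (mulgI rho)) /=.
  apply: le_trans (sum_arrangement_prob_ge1 (relabel rho w)) _.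
  by apply: ler_sum => s _; rewrite /step_prob mulKg.
apply: ler_sum => s _; rewrite -mulr_sumr ler_peMr ?step_prob_ge0 //.
Qed.

Definition unresolved (a : seq {ffun 'I_n -> int}) x y :=
  all (fun w : {ffun 'I_n -> int} => (w x == w y) && (w x != 0)) a.

(** Induction on the letters: the swap is carried along until the first step that resolves the pair,
    where it is absorbed. *)
Lemma path_prob_swap a rho theta x y : neighbours rho x y -> ~~ unresolved a x y ->
  path_prob a (tperm x y * rho)%g theta = path_prob a rho theta.
Proof.
elim: a rho => [|w a IH] rho //= nb; rewrite negb_and.
have [/andP[/eqP wxy w0] /= ua|free _] := boolP ((w x == w y) && (w x != 0)).
  (* Equal nonzero letters: swapping both decks keeps the step probability, and [x] and [y] stay
     neighbours in every [sigma] that can occur. *)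
  rewrite (reindex_inj (mulgI (tperm x y))) /=; apply: eq_bigr => sigma _.
  have -> : step_prob w (tperm x y * rho)%g (tperm x y * sigma)%g = step_prob w rho sigma.
    rewrite /step_prob; congr (arrangement_prob _ _ _).
      apply/ffunP => i; rewrite !ffunE invMg permM tpermV.
      by case: tpermP => // ->; rewrite wxy.
    by rewrite invMg mulgA mulgKV.
  rewrite step_probE; case: ifP => rs; last by rewrite !mul0r.
  by rewrite IH //; apply: neighbours_card_arranges nb _ _ rs.
have fr : w x != w y \/ w x = 0.
  by move: free; rewrite negb_and negbK => /orP[|/eqP]; [left|right].
(* Resolving letters: both initial decks allow the same [sigma]; as the swap is an involution, one
   implication yields the other. *)
apply: eq_bigr => sigma _; congr (_ * _); rewrite !step_probE.
suff -> : card_arranges w (tperm x y * rho)%g sigma = card_arranges w rho sigma by [].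
apply/idP/idP => [rs|]; last exact: card_arranges_swap.
have := card_arranges_swap (neighbours_tperm nb) fr rs.
by rewrite mulgA tperm2 mul1g.
Qed.

Lemma path_prob_resolved a rho theta : (forall x y, x != y -> ~~ unresolved a x y) ->
  path_prob a rho theta = path_prob a 1%g theta.
Proof.
move=> res; pose f r := path_prob a r theta.
apply: (@adjacent_invariant_const _ f) => r x y nb.
have [->|xy] := eqVneq x y; first by rewrite tperm1 mul1g.
by apply: path_prob_swap => //; apply: res.
Qed.

(** With an unresolved pair the left side is at most 0. Otherwise the start [rho] can be replaced by
    the identity, and [rho * pi] runs over all final decks, of total mass at least 1. *)
Lemma sum_path_prob_translates a pi :
  1 - \sum_(p : 'I_n * 'I_n | (p.1 < p.2)%N) (unresolved a p.1 p.2)%:R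
  <= \sum_rho path_prob a rho (rho * pi)%g.
Proof.
have [/existsP[[x y] /= /andP[xy u]]|] :=
    boolP [exists p : 'I_n * 'I_n, (p.1 < p.2)%N && unresolved a p.1 p.2].
  apply: le_trans (_ : 0 <= _); last by apply: sumr_ge0 => *; apply: path_prob_ge0.
  rewrite subr_le0 (bigD1 (x, y)) //= u lerDl.
  by apply: sumr_ge0 => *; apply: ler0n.
rewrite negb_exists => /forallP res.
rewrite big1 ?subr0 => [|p pp]; last first.
  by have := res p; rewrite pp /= => /negbTE ->.
have -> : \sum_rho path_prob a rho (rho * pi)%g = \sum_theta path_prob a 1%g theta.
  rewrite [RHS](reindex_inj (mulIg pi)) /=; apply: eq_bigr => rho _.
  apply: path_prob_resolved => x y.
  rewrite -(inj_eq val_inj) /= neq_ltn => /orP[] xy.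
    by have := res (x, y); rewrite xy.
  have := res (y, x); rewrite xy /=; apply: contra; apply: sub_all => w /andP[/eqP e].
  by rewrite e eqxx.
exact: sum_path_prob_ge1.
Qed.

Lemma card_ltn_pairs (m : nat) : #|[pred p : 'I_m * 'I_m | (p.1 < p.2)%N]| = 'C(m, 2).
Proof.
rewrite -bin2_sum big_mkord -sum1_card.
transitivity (\sum_(j < m) \sum_(i < m | (i < j)%N) 1)%N.
  rewrite [RHS](exchange_big_dep predT) //= pair_big_dep /=.
  by apply: eq_bigl => p; rewrite inE.
apply: eq_bigr => j _; rewrite sum1_card -[RHS](card_ord_lt (ltnW (ltn_ord j))).
by apply: eq_card => i; rewrite !inE.
Qed.

(** * Shuffles with a finite alphabet *)

Section FiniteAlphabet.
Variables (T : finType) (v : T -> int) (p : T -> R).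
Hypothesis p_ge0 : forall x, 0 <= p x.
Hypothesis v_inj : injective v.

Definition int_word (u : {ffun 'I_n -> T}) : {ffun 'I_n -> int} := [ffun j => v (u j)].

Definition weight (u : {ffun 'I_n -> T}) : R := \prod_j p (u j).

Definition fin_shuffle pi : R := \sum_u weight u * arrangement_prob R (int_word u) pi.

Lemma weight_ge0 u : 0 <= weight u.
Proof. exact: prodr_ge0. Qed.

(** Integral of [F] over [k] independent words; as [p] may have mass below 1, it is not
    normalized. *)
Fixpoint expect k (F : seq {ffun 'I_n -> int} -> R) : R :=
  if k is k'.+1 then \sum_u weight u * expect k' (fun a => F (int_word u :: a))
  else F [::].

Lemma expect_le k F G : (forall a, F a <= G a) -> expect k F <= expect k G.
Proof.
elim: k F G => [|k IH] F G FG //=; apply: ler_sum => u _.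
by apply: ler_wpM2l; [exact: weight_ge0|exact: IH].
Qed.

Lemma expectZ k c F : expect k (fun a => c * F a) = c * expect k F.
Proof.
elim: k F => [|k IH] F //=; rewrite mulr_sumr; apply: eq_bigr => u _.
by rewrite IH mulrCA.
Qed.

Lemma expect_sum k (I : Type) (r : seq I) (P : pred I) F :
  expect k (fun a => \sum_(i <- r | P i) F i a) = \sum_(i <- r | P i) expect k (F i).
Proof.
elim: k F => [|k IH] F //=; rewrite exchange_big /=; apply: eq_bigr => u _.
by rewrite IH mulr_sumr.
Qed.

Lemma expectB k F G : expect k (fun a => F a - G a) = expect k F - expect k G.
Proof.
elim: k F G => [|k IH] F G //=; rewrite -sumrB; apply: eq_bigr => u _.
by rewrite IH mulrBr.
Qed.

Lemma expect1 k : expect k (fun=> 1) = (\sum_x p x) ^+ (n * k).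
Proof.
rewrite exprM; elim: k => [|k IH] //=; rewrite exprS IH -mulr_suml; congr (_ * _).
rewrite -[in RHS](card_ord n) -prodr_const.
by rewrite (bigA_distr_bigA (fun (_ : 'I_n) => p)).
Qed.

Lemma expect_all k (P : pred {ffun 'I_n -> int}) :
  expect k (fun a => (all P a)%:R) = (\sum_u weight u * (P (int_word u))%:R) ^+ k.
Proof.
elim: k => [|k IH] //=; rewrite exprS mulr_suml; apply: eq_bigr => u _.
rewrite -IH -mulrA; congr (_ * _); rewrite -expectZ; congr expect; apply/funext => a.
by rewrite -natrM mulnb.
Qed.

(** Letters are independent and identically distributed, so attaching them to cards instead of
    positions keeps the law. *)
Lemma fin_shuffle_power k rho theta :
  convolution_power fin_shuffle k (rho^-1 * theta)%g =
  expect k (fun a => path_prob a rho theta).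
Proof.
elim: k rho => [|k IH] rho /=; first by rewrite /convolution_power /= /point_mass1 -eq_mulVg1.
rewrite /convolution_power /= -/(convolution_power _ _) /convolution.
rewrite (reindex_inj (mulgI rho^-1%g)) /=.
under eq_bigr => sigma _ do rewrite invMg invgK mulgA mulgK IH /fin_shuffle mulr_suml.
rewrite exchange_big /=.
(* [h] turns letters indexed by cards into letters indexed by positions in the deck [rho]. *)
pose h (u : {ffun 'I_n -> T}) : {ffun 'I_n -> T} := [ffun j => u (rho^-1%g j)].
have h_inj : injective h.
  move=> u1 u2 /ffunP e; apply/ffunP => j; have := e (rho j).
  by rewrite !ffunE permK.
rewrite (reindex_inj h_inj) /=; apply: eq_bigr => u _.
have -> : weight (h u) = weight u.
  rewrite /weight (reindex_inj (@perm_inj _ rho)) /=.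
  by apply: eq_bigr => j _; rewrite ffunE permK.
have -> : int_word (h u) = relabel rho (int_word u).
  by apply/ffunP => j; rewrite !ffunE.
rewrite expect_sum mulr_sumr; apply: eq_bigr => sigma _.
by rewrite expectZ mulrA.
Qed.

Hypothesis p_le1 : \sum_x p x <= 1.

(** Sum over the common letter [c]: the positions [x] and [y] contribute [p c ^+ 2], every other
    position a factor at most 1. *)
Lemma collision_le x y : x != y ->
  \sum_u weight u * ((int_word u x == int_word u y) && (int_word u x != 0))%:R
  <= \sum_(c | v c != 0) p c ^+ 2.
Proof.
move=> xy.
(* Forcing [c] at [x] and [y] through a factor at each position lets the sum over words split into a
   product. *)
pose g c (j : 'I_n) d : R := p d * (((j == x) || (j == y)) ==> (d == c))%:R.
have -> : \sum_u weight u * ((int_word u x == int_word u y) && (int_word u x != 0))%:R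
   = \sum_(c | v c != 0) \sum_(u : {ffun 'I_n -> T}) \prod_j g c j (u j).
  rewrite exchange_big /=; apply: eq_bigr => u _; rewrite !ffunE (inj_eq v_inj).
  have E c : \prod_j g c j (u j) = weight u * ((u x == c) && (u y == c))%:R.
    rewrite big_split /=; congr (_ * _).
    rewrite (bigD1 x) //= (bigD1 y) /= 1?eq_sym // !eqxx /= orbT /=.
    rewrite big1 => [|j /andP[/negbTE -> /negbTE ->]] //.
    by rewrite mulr1 -natrM mulnb.
  under eq_bigr => c _ do rewrite E.
  rewrite -mulr_sumr; congr (_ * _).
  (* For a given word at most one [c] contributes. *)
  have [<-|uxy] /= := eqVneq (u x) (u y).
    under eq_bigr => c _ do rewrite andbb.
    have [u0|u0] /= := boolP (v (u x) != 0).
      rewrite (bigD1 (u x)) //= eqxx big1 ?addr0 // => c /andP[_].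
      by rewrite eq_sym => /negbTE ->.
    rewrite big1 // => c c0; case: eqP => // e; by rewrite -e (negbTE u0) in c0.
  rewrite big1 // => c _; case: eqP => //= <-.
  by rewrite eq_sym (negbTE uxy).
apply: ler_sum => c _; rewrite -(bigA_distr_bigA (g c)).
have gle j : 0 <= \sum_d g c j d <= 1.
  rewrite sumr_ge0 /= => [|d _]; last by rewrite mulr_ge0.
  apply: le_trans p_le1; apply: ler_sum => d _.
  by rewrite ler_piMr // lern1 leq_b1.
have gE j : (j == x) || (j == y) -> \sum_d g c j d = p c.
  move=> jj; rewrite (bigD1 c) //= big1 => [|d /negbTE dc].
    by rewrite /g jj eqxx mulr1 addr0.
  by rewrite /g jj dc mulr0.
rewrite (bigD1 x) //= (bigD1 y) /= 1?eq_sym // !gE ?eqxx ?orbT // mulrA -expr2.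
by rewrite ler_piMr ?sqr_ge0 //; apply: prodr_ile1.
Qed.

Lemma fin_shuffle_power_ge k pi :
  (\sum_x p x) ^+ (n * k) - 'C(n, 2)%:R * (\sum_(c | v c != 0) p c ^+ 2) ^+ k
  <= n`!%:R * convolution_power fin_shuffle k pi.
Proof.
(* Each of the [n!] relabellings [rho] contributes the same probability, that of moving the deck by
   [pi]. *)
have -> : n`!%:R * convolution_power fin_shuffle k pi =
    expect k (fun a => \sum_rho path_prob a rho (rho * pi)%g).
  rewrite expect_sum mulr_natl -card_Sn -sumr_const; apply: eq_bigr => rho _.
  by rewrite -fin_shuffle_power mulKg.
apply: le_trans (expect_le k (fun a => sum_path_prob_translates a pi)).
rewrite expectB expect1 expect_sum lerD2l lerN2 mulr_natl -card_ltn_pairs -sumr_const.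
apply: ler_sum => -[x y] /= xy; rewrite expect_all lerXn2r ?nnegrE //.
- by apply: sumr_ge0 => u _; rewrite mulr_ge0 ?weight_ge0.
- by apply: sumr_ge0 => c _; apply: sqr_ge0.
- by apply: collision_le; rewrite neq_ltn xy.
Qed.

End FiniteAlphabet.
End Arrangements.

(** Transfers lower bounds from a truncated measure to the full shuffle above it. *)
Lemma convolution_power_mono (R : realType) (n k : nat) (P Q : 'S_n -> R) :
  (forall s, 0 <= P s) -> (forall s, P s <= Q s) ->
  forall s, 0 <= convolution_power P k s <= convolution_power Q k s.
Proof.
move=> P0 PQ; elim: k => [|k IH] s; first by rewrite /convolution_power /= lexx andbT ler0n.
rewrite /convolution_power /= -!/(convolution_power _ _) /convolution.
apply/andP; split; [apply: sumr_ge0|apply: ler_sum] => t _.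
  by rewrite mulr_ge0 //; case/andP: (IH (t^-1 * s)%g).
by case/andP: (IH (t^-1 * s)%g) => *; apply: ler_pM.
Qed.

(** The alphabet from -M to M: [Negz i] denotes -(i+1), so both halves have absolute values 1 to
    M. *)
Definition letters (M : nat) := (unit + ('I_M + 'I_M))%type.

Definition letter_val (M : nat) (x : letters M) : int :=
  match x with
  | inl _ => 0
  | inr (inl i) => Posz i.+1
  | inr (inr i) => Negz i
  end.

Lemma letter_val_inj M : injective (@letter_val M).
Proof. by move=> [[]|[i|i]] [[]|[j|j]] //= [] /val_inj ->. Qed.

Lemma letter_val_surj M (a : int) : (`|a| < M)%N -> exists x, @letter_val M x = a.
Proof.
case: a => [[|i]|i] /= iM; first by exists (inl tt).
  by exists (inr (inl (Ordinal (ltnW iM)))).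
by exists (inr (inr (Ordinal (ltnW iM)))).
Qed.

(** * Truncation of the alphabet *)

Section Truncation.
Variables (R : realType) (alpha beta : nat -> R) (gamma : R) (n : nat).
Hypothesis alpha_ge0 : forall i : nat, (1 <= i)%N -> 0 <= alpha i.
Hypothesis beta_ge0 : forall i : nat, (1 <= i)%N -> 0 <= beta i.
Hypothesis gamma_ge0 : 0 <= gamma.
Hypothesis sum_eq1 : (gamma%:E + \sum_(1 <= i <oo) (alpha i)%:E
                  + \sum_(1 <= i <oo) (beta i)%:E = 1%:E)%E.

Definition trunc_prob M (x : letters M) : R := letter_prob alpha beta gamma (letter_val x).

(** The sums stop before [M], so the alphabet [letters M] has mass [partial_mass M.+1]. *)
Definition partial_mass M : R :=
  gamma + \sum_(1 <= i < M) alpha i + \sum_(1 <= i < M) beta i.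

Definition partial_squares M : R :=
  \sum_(1 <= i < M) alpha i ^+ 2 + \sum_(1 <= i < M) beta i ^+ 2.

Lemma letter_prob_ge0 a : 0 <= letter_prob alpha beta gamma a.
Proof.
rewrite /letter_prob; case: ifP => [a0|_]; first by apply: alpha_ge0; rewrite absz_gt0 gt_eqF.
by case: ifP => // a0; apply: beta_ge0; rewrite absz_gt0 lt_eqF.
Qed.

Lemma sum_trunc_prob M : \sum_(x : letters M) trunc_prob x = partial_mass M.+1.
Proof.
rewrite !big_sumType /= addrA (big_pred1 tt) => [|[]] //.
by rewrite /partial_mass !big_add1 !big_mkord.
Qed.

Lemma sum_trunc_prob_sqr M :
  \sum_(x : letters M | letter_val x != 0) trunc_prob x ^+ 2 = partial_squares M.+1.
Proof.
by rewrite !big_sumType /= big_pred0 // add0r /partial_squares !big_add1 !big_mkord.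
Qed.

Lemma nondecreasing_partial_sum (f : nat -> R) :
  (forall i, (1 <= i)%N -> 0 <= f i) -> nondecreasing_seq (fun M => \sum_(1 <= i < M) f i).
Proof.
move=> f0; apply/nondecreasing_seqP => -[|M].
  by rewrite big_geq // big_geq.
by rewrite [leRHS]big_nat_recr //= lerDl f0.
Qed.

Lemma nondecreasing_partial_mass : nondecreasing_seq partial_mass.
Proof.
move=> M N MN; rewrite /partial_mass -!addrA lerD2l lerD //;
  exact: nondecreasing_partial_sum MN.
Qed.

Lemma partial_mass_cvg : (partial_mass M @[M --> \oo] --> (1 : R))%classic.
Proof.
have cvg_sum (f : nat -> R) : (forall i, (1 <= i)%N -> 0 <= f i) ->
    (0 <= \sum_(1 <= i <oo) (f i)%:E)%E /\
    ((\sum_(1 <= i < M) f i)%:E @[M --> \oo] --> (\sum_(1 <= i <oo) (f i)%:E)%E)%classic.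
  move=> f0; split; first by apply: nneseries_ge0 => i i1 _; rewrite lee_fin f0.
  under eq_fun => M do rewrite -sumEFin.
  by apply: is_cvg_nneseries => i i1 _; rewrite lee_fin f0.
have [SA0 SA] := cvg_sum _ alpha_ge0; have [SB0 SB] := cvg_sum _ beta_ge0.
apply: (@fine_cvg _ _ _ _ (EFin \o partial_mass)); rewrite -sum_eq1.
have -> : EFin \o partial_mass = (fun M => gamma%:E + (\sum_(1 <= i < M) alpha i)%:E
    + (\sum_(1 <= i < M) beta i)%:E)%E by [].
apply: cvgeD => //.
  by apply: ge0_adde_def; rewrite inE ?adde_ge0 ?lee_fin.
by apply: cvgeD => //; apply: cvg_cst.
Qed.

Lemma partial_mass_le1 M : partial_mass M <= 1.
Proof.
rewrite -(cvg_lim _ partial_mass_cvg) //; apply: nondecreasing_cvgn_le.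
  exact: nondecreasing_partial_mass.
by apply/cvg_ex; exists 1; exact: partial_mass_cvg.
Qed.

Let s : R := \big[+%R/0]_(1 <= i <oo) alpha i ^+ 2 + \big[+%R/0]_(1 <= i <oo) beta i ^+ 2.

(** Terms are at most 1, so partial sums of squares are bounded by those of the terms; being
    monotone, they converge and stay below their limit. *)
Lemma partial_squares_le M : partial_squares M <= s.
Proof.
have le_lim (f : nat -> R) : (forall i, (1 <= i)%N -> 0 <= f i) ->
    (forall M, \sum_(1 <= i < M) f i <= 1) ->
    \sum_(1 <= i < M) f i ^+ 2 <= \big[+%R/0]_(1 <= i <oo) f i ^+ 2.
  move=> f0 f1; have f01 i : (1 <= i)%N -> f i <= 1.
    move=> i1; apply: le_trans (f1 i.+1); rewrite [leRHS]big_nat_recr //= lerDr.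
    by rewrite big_nat; apply: sumr_ge0 => j /andP[/f0].
  have nd : nondecreasing_seq (fun M => \sum_(1 <= i < M) f i ^+ 2).
    by apply: nondecreasing_partial_sum => i _; apply: sqr_ge0.
  apply: (nondecreasing_cvgn_le nd); apply: nondecreasing_is_cvgn => //.
  exists 1 => _ [N _ <-]; apply: le_trans (f1 N); rewrite big_nat [leRHS]big_nat.
  by apply: ler_sum => i /andP[i1 _]; rewrite expr2 ler_piMr ?f0 ?f01.
have sum0 (f : nat -> R) N : (forall i, (1 <= i)%N -> 0 <= f i) -> 0 <= \sum_(1 <= i < N) f i.
  by move=> f0; rewrite big_nat; apply: sumr_ge0 => j /andP[/f0].
apply: lerD; apply: le_lim => // N; apply: le_trans (partial_mass_le1 N);
  rewrite /partial_mass.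
- by rewrite addrAC lerDr addr_ge0 ?sum0.
- by rewrite lerDr addr_ge0 ?sum0.
Qed.

Lemma partial_squares_ge0 M : 0 <= partial_squares M.
Proof. by rewrite addr_ge0 //; apply: sumr_ge0 => i _; apply: sqr_ge0. Qed.

(** * The sum over all words and its finite parts *)

Let term (pi : 'S_n) w := (word_prob alpha beta gamma w * arrangement_prob R w pi)%:E.

Definition trunc_words M : seq {ffun 'I_n -> int} :=
  [seq int_word (@letter_val M) u | u <- enum {: {ffun 'I_n -> letters M}}].

Lemma fsum_trunc_words M pi :
  (\sum_(w \in [set` trunc_words M]%classic) term pi w)%E =
  (fin_shuffle (@letter_val M) (@trunc_prob M) pi)%:E.
Proof.
rewrite -fsbig_seq; last first.
  rewrite map_inj_uniq ?enum_uniq // => u1 u2 /ffunP e; apply/ffunP => j.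
  by have := e j; rewrite !ffunE => /letter_val_inj.
rewrite big_map big_enum /= sumEFin; congr EFin; apply: eq_bigr => u _.
by congr (_ * _); apply: eq_bigr => j _; rewrite ffunE.
Qed.

Lemma mem_trunc_words M (w : {ffun 'I_n -> int}) :
  (forall j, (`|w j| < M)%N) -> w \in trunc_words M.
Proof.
move=> wM; have [u uE] := choice (fun j => letter_val_surj (wM j)).
apply/mapP; exists [ffun j => u j]; first by rewrite mem_enum.
by apply/ffunP => j; rewrite !ffunE uE.
Qed.

Lemma term_ge0 pi w : (0 <= term pi w)%E.
Proof.
rewrite lee_fin mulr_ge0 ?arrangement_prob_ge0 //.
by apply: prodr_ge0 => j _; apply: letter_prob_ge0.
Qed.

Lemma trunc_prob_ge0 M (x : letters M) : 0 <= trunc_prob x.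
Proof. exact: letter_prob_ge0. Qed.

Lemma arrangement_prob_le1 w (pi : 'S_n) : arrangement_prob R w pi <= 1.
Proof.
rewrite /arrangement_prob; case: ifP => // _.
by rewrite invf_le1 ?ltr0n ?fact_gt0 // ler1n fact_gt0.
Qed.

Lemma fin_shuffle_le1 M (pi : 'S_n) : fin_shuffle (@letter_val M) (@trunc_prob M) pi <= 1 :> R.
Proof.
apply: le_trans (_ : \sum_(u : {ffun 'I_n -> letters M}) weight (@trunc_prob M) u <= _).
  apply: ler_sum => u _; rewrite ler_piMr ?arrangement_prob_le1 //.
  by apply: weight_ge0; apply: trunc_prob_ge0.
rewrite -(bigA_distr_bigA (fun (_ : 'I_n) => @trunc_prob M)); apply: prodr_ile1 => j _.
rewrite sumr_ge0 ?sum_trunc_prob ?partial_mass_le1 // => x _.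
exact: trunc_prob_ge0.
Qed.

Lemma esum_term_le1 pi : (\esum_(w in [set: {ffun 'I_n -> int}]) term pi w <= 1%:E)%E.
Proof.
apply: ge_ereal_sup => _ [X [finX _] <-].
(* The largest absolute value of a letter in [X]; membership in [trunc_words] asks for a strict
   bound, hence [M.+1] below. *)
pose M := \max_(w <- finmap.enum_fset (fset_set X)) \max_(j < n) `|w j|%N.
apply: le_trans (_ : ((\sum_(w \in [set` trunc_words M.+1]) term pi w)%E <= _)%E).
  apply: (lee_fsum_nneg_subset finX (finite_seq _)) => [w wX|w _]; last exact: term_ge0.
  rewrite mem_setE; apply: mem_trunc_words => j; rewrite ltnS.
  apply: (@leq_trans (\max_(j < n) `|w j|%N)); first exact: leq_bigmax.
  apply: (@leq_bigmax_seq _ _ predT (fun w : {ffun 'I_n -> int} => \max_(j < n) `|w j|%N)) => //.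
  by have := in_fset_set finX w; rewrite wX.
by rewrite fsum_trunc_words lee_fin fin_shuffle_le1.
Qed.

Lemma fin_shuffle_le M (pi : 'S_n) :
  fin_shuffle (@letter_val M) (@trunc_prob M) pi <= shuffle alpha beta gamma pi.
Proof.
have le1 := esum_term_le1 pi.
(* Finiteness comes first, since [fine] would send an infinite sum to 0. *)
have fin : \esum_(w in [set: {ffun 'I_n -> int}]) term pi w \is a fin_num.
  rewrite ge0_fin_numE; first exact: le_lt_trans le1 (ltry _).
  by apply: esum_ge0 => w _; apply: term_ge0.
rewrite -lee_fin /shuffle fineK // -fsum_trunc_words.
apply: esum_ge; exists [set` trunc_words M]%classic => //.
by split => //; exact: finite_seq.
Qed.

(** The finite-alphabet bound holds for every [M]; its square sums are at most [s], and its mass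
    term tends to 1. *)
Lemma shuffle_power_ge k (pi : 'S_n) :
  1 - 'C(n, 2)%:R * s ^+ k <= n`!%:R * convolution_power (shuffle alpha beta gamma (n:=n)) k pi.
Proof.
rewrite lerBlDr.
have cv : (partial_mass M.+1 ^+ (n * k) @[M --> \oo] --> (1 : R))%classic.
  have := partial_mass_cvg; rewrite -cvg_shiftS.
  by move/(continuous_cvg _ (@exprn_continuous R (n * k) 1)); rewrite expr1n.
apply: (cvgr_to_le cv); apply: nearW => M.
rewrite -lerBlDr.
apply: le_trans (_ : partial_mass M.+1 ^+ (n * k) - 'C(n, 2)%:R * partial_squares M.+1 ^+ k <= _).
  rewrite lerD2l lerN2 ler_wpM2l // lerXn2r ?nnegrE ?partial_squares_ge0 ?partial_squares_le //.
  exact: le_trans (partial_squares_ge0 M.+1) (partial_squares_le _).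
rewrite -sum_trunc_prob -sum_trunc_prob_sqr.
apply: le_trans (fin_shuffle_power_ge _ _ _ _ pi) _.
- exact: trunc_prob_ge0.
- exact: letter_val_inj.
- by rewrite sum_trunc_prob partial_mass_le1.
rewrite ler_wpM2l //.
have fin_ge0 (s' : 'S_n) : 0 <= fin_shuffle (@letter_val M) (@trunc_prob M) s'.
  apply: sumr_ge0 => u _; rewrite mulr_ge0 ?arrangement_prob_ge0 ?weight_ge0 //.
  exact: trunc_prob_ge0.
by have /andP[] := convolution_power_mono k fin_ge0 (@fin_shuffle_le M) pi.
Qed.

Lemma separation_distance_le k :
  separation_distance (convolution_power (shuffle alpha beta gamma (n:=n)) k)
  <= 'C(n, 2)%:R * s ^+ k.
Proof.
have F pi : 1 - convolution_power (shuffle alpha beta gamma (n:=n)) k pi / uniform_perm R pi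
    <= 'C(n, 2)%:R * s ^+ k.
  rewrite /uniform_perm invrK -cardsT -[#|[set: 'S_n]%SET|]/(#|[set: {perm 'I_n}]%SET|).
  rewrite cardsT card_Sn mulrC lerBlDr -lerBlDl; exact: shuffle_power_ge.
(* The base value of the maximum is itself one of the bounded terms. *)
by apply: bigmax_le.
Qed.

End Truncation.

(** * The number of steps *)

Lemma expR_log_base_bound (R : realType) (s : R) (n : nat) (c : R) (k : nat) :
  0 < s -> s < 1 -> (1 <= n)%N -> 2 * log_base (1 / s) n%:R + c <= k%:R ->
  s ^+ k <= s `^ c / n%:R ^+ 2.
Proof.
move=> s0 s1 n1; have n0 : (0 : R) < n%:R by rewrite ltr0n.
have L0 : ln s < 0 by rewrite ln_lt0 // s0.
rewrite /log_base div1r lnV ?posrE // invrN mulrN => hk.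
rewrite -powR_mulrn ?(ltW s0) // /powR gt_eqF //.
have -> : n%:R ^+ 2 = expR (ln n%:R * 2) :> R by rewrite expRM_natr lnK ?posrE.
rewrite -expRN -expRD ler_expR.
move: hk; set l := ln n%:R; set L := ln s => hk.
(* Multiplying by the negative [ln s] reverses the bound on [k] and turns the logarithm term into -2
   ln n. *)
have := ler_wnM2r (ltW L0) hk; rewrite mulrDl -/L.
suff -> : 2 * - (l / L) * L = - (l * 2) by rewrite addrC.
by field; rewrite lt_eqF.
Qed.

(** Closeness is made quantitative by [c]: with [c] steps beyond the stated number, the distance is
    at most [s] to the power [c], halved. *)
Theorem theorem8 (R : realType) (alpha beta : nat -> R) (gamma : R) (n : nat)
    (alpha_ge0 : forall i : nat, (1 <= i)%N -> 0 <= alpha i)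
    (beta_ge0 : forall i : nat, (1 <= i)%N -> 0 <= beta i)
    (gamma_ge0 : 0 <= gamma)
    (sum_eq1 : (gamma%:E + \sum_(1 <= i <oo) (alpha i)%:E
                  + \sum_(1 <= i <oo) (beta i)%:E = 1%:E)%E) :
  let s : R := \big[+%R/0]_(1 <= i <oo) alpha i ^+ 2
               + \big[+%R/0]_(1 <= i <oo) beta i ^+ 2 in
  let sep (k : nat) : R :=
    separation_distance (convolution_power (@shuffle R alpha beta gamma n) k) in
  (forall k : nat, sep k <= 'C(n, 2)%:R * s ^+ k)
  /\
  (0 < s -> s < 1 -> (1 <= n)%N ->
   forall (c : R) (k : nat), 0 <= c ->
     2 * log_base (1 / s) n%:R + c <= k%:R -> sep k <= s `^ c / 2).
Proof.
move=> s sep; have sepP k : sep k <= 'C(n, 2)%:R * s ^+ k by apply: separation_distance_le.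
split=> // s0 s1 n1 c k _ hk; apply: le_trans (sepP k) _.
apply: le_trans (_ : 'C(n, 2)%:R * (s `^ c / n%:R ^+ 2) <= _).
  by rewrite ler_wpM2l // expR_log_base_bound.
rewrite mulrCA ler_wpM2l ?powR_ge0 // ler_pdivrMr ?exprn_gt0 ?ltr0n //.
(* Twice the binomial coefficient is n(n-1), at most the square of n. *)
rewrite ler_pdivlMl // -natrX -natrM ler_nat bin2 mul2n.
have := leq_trunc_div (n * n.-1) 2; lia.
Qed.
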